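(* Let $\gamma:I\to G_3^1$ be a Frenet curve of osculating order $3$ in the equiform geometry of the pseudo-Galilean space $G_3^1$, with equiform curvature $\mathcal{K}$ and equiform torsion $\mathcal{T}$. Then $\gamma$ is of type equiform AW$(3)$ if and only if $$\mathcal{T}'-3\mathcal{K}\mathcal{T}=0,$$ where $'$ on $\mathcal{T}$ denotes the derivative with respect to the equiform parameter $\sigma$.
   Context: Pseudo-Galilean space. $G_3^1$ is $\mathbb{R}^3$ with the scalar product $\langle u,v\rangle=u_1v_1$ if $u_1\neq0$ or $v_1\neq 0$, and $\langle u,v\rangle=u_2v_2-u_3v_3$ if $u_1=v_1=0$. Curves. Curves are sufficiently smooth admissible curves (no inflection points, no isotropic tangents, no lightlike principal normals), parametrized by arc length $s=x$: $\gamma(s)=(s,y(s),z(s))$ with $y''(s)\neq\pm z''(s)$ for all $s$ in an interval $I$. The curvature and torsion are $\kappa=\sqrt{|y''^2-z''^2|}>0$ and $\tau=(y''z'''-y'''z'')/\kappa^2$. The trihedron is $\mathbf{e}_1=(1,y',z')$, $\mathbf{e}_2=\frac1\kappa(0,y'',z'')$, $\mathbf{e}_3=\frac1\kappa(0,\epsilon z'',\epsilon y'')$, where $\epsilon=\pm1$ satisfies $|y''^2-z''^2|=\epsilon(y''^2-z''^2)$. It satisfies $\mathbf{e}_1'=\kappa\mathbf{e}_2$, $\mathbf{e}_2'=\tau\mathbf{e}_3$, $\mathbf{e}_3'=\tau\mathbf{e}_2$. Equiform geometry. Let $\rho=1/\kappa$. The equiform parameter is $\sigma=\int\kappa\,ds$.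 The equiform frame is $\mathbf{T}=\rho\mathbf{e}_1$, $\mathbf{N}=\rho\mathbf{e}_2$, $\mathbf{B}=\rho\mathbf{e}_3$. The equiform curvature is $\mathcal{K}=d\rho/ds$ and the equiform torsion is $\mathcal{T}=\rho\tau=\tau/\kappa$. Below, $\mathcal{K}'=d\mathcal{K}/d\sigma$ and $\mathcal{T}'=d\mathcal{T}/d\sigma$. Osculating order. A Frenet curve of osculating order $3$ is a curve for which the $s$-derivatives $\gamma',\gamma'',\gamma'''$ are linearly independent and $\gamma',\gamma'',\gamma''',\gamma''''$ are no longer linearly independent, for all $s\in I$. AW(3) type. Put $Q_1=\frac1{\rho^2}\mathbf{N}$ and $Q_3=\frac1{\rho^4}[(2\mathcal{K}^2+\mathcal{T}^2-\mathcal{K}')\mathbf{N}+(\mathcal{T}'-3\mathcal{K}\mathcal{T})\mathbf{B}]$. Write $\|v\|^2=\langle v,v\rangle$. A Frenet curve of osculating order $3$ is of type equiform AW$(3)$ if $\|Q_1\|^2Q_3=\langle Q_3,Q_1\rangle Q_1$ for all $s\in I$. *)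

(* Defs.v *)
From HB Require Import structures.
From mathcomp Require Import all_boot all_order all_algebra.
From mathcomp Require Import all_classical all_reals all_analysis.
Set Implicit Arguments.
Unset Strict Implicit.
Unset Printing Implicit Defensive.
Import Order.TTheory GRing.Theory Num.Theory.
Import numFieldNormedType.Exports.
Local Open Scope ring_scope.
Local Open Scope classical_set_scope.

Section PseudoGalilean.
Variable R : realType.
Implicit Types (I : interval R) (y z sigma f : R -> R) (u v : 'rV[R]_3).

Definition vec3 (a b c : R) : 'rV[R]_3 := \row_(i < 3) [:: a; b; c]`_i.

(* The coordinates u_1, u_2, u_3 are the entries 0, 1, 2 of the row vector. *)
Definition sprod u v : R :=
  let i0 : 'I_3 := inord 0 in
  let i1 : 'I_3 := inord 1 in
  let i2 : 'I_3 := inord 2 in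
  if (u ord0 i0 != 0) || (v ord0 i0 != 0) then u ord0 i0 * v ord0 i0
  else u ord0 i1 * v ord0 i1 - u ord0 i2 * v ord0 i2.

Definition sqnorm v : R := sprod v v.

Definition curve y z : R -> 'rV[R]_3 := fun s => vec3 s (y s) (z s).

(* The interval need not be open.  Functions are total, and "of class C^n at s"
   refers to a neighbourhood of s in R; so, at an endpoint belonging to I, a
   smooth function is one that extends smoothly beyond it, and its two-sided
   derivatives are then the one-sided derivatives of its restriction to I. *)
Definition class_C (n : nat) f (s : R) : Prop :=
  (forall k, (k < n)%N -> \forall t \near s, derivable f^`(k) t 1) /\
  (\forall t \near s, {for t, continuous f^`(n)}).

Definition curv_form y z (s : R) : R :=
  derive1n 2 y s ^+ 2 - derive1n 2 z s ^+ 2.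

(* Order 4 is the one needed for T' and K' (and for gamma'''') to exist. *)
Definition admissible I y z : Prop :=
  forall s, s \in I ->
    [/\ class_C 4 y s, class_C 4 z s,
        derive1n 2 y s <> derive1n 2 z s & derive1n 2 y s <> - derive1n 2 z s].

Definition kappa y z (s : R) : R := Num.sqrt `|curv_form y z s|.

Definition tau y z (s : R) : R :=
  (derive1n 2 y s * derive1n 3 z s
   - derive1n 3 y s * derive1n 2 z s) / kappa y z s ^+ 2.

Definition eps y z (s : R) : R := Num.sg (curv_form y z s).

Lemma epsP I y z s : admissible I y z -> s \in I ->
  (eps y z s = 1 \/ eps y z s = -1) /\
  `|curv_form y z s| = eps y z s * curv_form y z s.
Proof.
move=> adm /adm [_ _ /eqP yz /eqP yNz]; split; last by rewrite normrEsg.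
have : curv_form y z s != 0.
  by rewrite /curv_form subr_sqr mulf_neq0 ?subr_eq0 ?addr_eq0.
rewrite /eps; case: sgrP => // _ _; [by left | by right].
Qed.

Definition e1 y z (s : R) : 'rV[R]_3 := vec3 1 (derive1 y s) (derive1 z s).

Definition e2 y z (s : R) : 'rV[R]_3 :=
  (kappa y z s)^-1 *: vec3 0 (derive1n 2 y s) (derive1n 2 z s).

Definition e3 y z (s : R) : 'rV[R]_3 :=
  (kappa y z s)^-1 *:
    vec3 0 (eps y z s * derive1n 2 z s) (eps y z s * derive1n 2 y s).

Definition rho y z (s : R) : R := (kappa y z s)^-1.

(* sigma = \int kappa ds, an indefinite integral: sigma is determined up to an
   additive constant. *)
Definition equiform_parameter I y z sigma : Prop :=
  forall s, s \in I -> is_derive s 1 sigma (kappa y z s).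

(* df/dsigma at s, as the limit of (f t - f s) / (sigma t - sigma s) for
   t -> s, t <> s. *)
Definition dparam sigma f (s : R) : R :=
  lim ((f t - f s) / (sigma t - sigma s) @[t --> s^']).

Definition equiT y z (s : R) : 'rV[R]_3 := rho y z s *: e1 y z s.
Definition equiN y z (s : R) : 'rV[R]_3 := rho y z s *: e2 y z s.
Definition equiB y z (s : R) : 'rV[R]_3 := rho y z s *: e3 y z s.

Definition equi_curvature y z : R -> R := (rho y z)^`().

Definition equi_torsion y z (s : R) : R := rho y z s * tau y z s.

Definition frenet_order3 I y z : Prop :=
  let g := curve y z in
  forall s, s \in I ->
    free [:: g^`(1) s; g^`(2) s; g^`(3) s] /\
    ~~ free [:: g^`(1) s; g^`(2) s; g^`(3) s; g^`(4) s].

Definition Q1 y z (s : R) : 'rV[R]_3 := (rho y z s ^+ 2)^-1 *: equiN y z s.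

Definition Q3 y z sigma (s : R) : 'rV[R]_3 :=
  let K := equi_curvature y z in
  let T := equi_torsion y z in
  (rho y z s ^+ 4)^-1 *:
    ((2 * K s ^+ 2 + T s ^+ 2 - dparam sigma K s) *: equiN y z s
     + (dparam sigma T s - 3 * K s * T s) *: equiB y z s).

Definition equiform_AW3 I y z sigma : Prop :=
  forall s, s \in I ->
    sqnorm (Q1 y z s) *: Q3 y z sigma s
    = sprod (Q3 y z sigma s) (Q1 y z s) *: Q1 y z s.

End PseudoGalilean.

(* Main.v *)
(* N and B are orthogonal isotropic vectors, with <N, N> != 0 and B != 0 because
   y'' <> +- z''.  Since Q1 is a nonzero multiple of N, the AW(3) condition says
   that the part of Q3 orthogonal to N, that is its B-component, vanishes. *)
Require Import Defs.
From mathcomp Require Import all_boot all_order all_algebra.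
From mathcomp Require Import all_classical all_reals all_analysis.
From mathcomp Require Import ring lra.
Import Order.TTheory GRing.Theory Num.Theory.
Import numFieldNormedType.Exports.
Local Open Scope ring_scope.
Local Open Scope classical_set_scope.

Lemma scale_vec3 (R : realType) (k a b c : R) :
  k *: vec3 a b c = vec3 (k * a) (k * b) (k * c).
Proof. by apply/rowP => -[[|[|[|//]]] ?]; rewrite !mxE. Qed.

Lemma add_vec3 (R : realType) (a b c a' b' c' : R) :
  vec3 a b c + vec3 a' b' c' = vec3 (a + a') (b + b') (c + c').
Proof. by apply/rowP => -[[|[|[|//]]] ?]; rewrite !mxE. Qed.

Lemma vec3_inj (R : realType) (a b c a' b' c' : R) :
  vec3 a b c = vec3 a' b' c' -> [/\ a = a', b = b' & c = c'].
Proof.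
move=> /rowP e; split.
- by have := e (inord 0); rewrite !mxE !inordK.
- by have := e (inord 1); rewrite !mxE !inordK.
- by have := e (inord 2); rewrite !mxE !inordK.
Qed.

Lemma sprod_isotropic (R : realType) (a b c d : R) :
  sprod (vec3 0 a b) (vec3 0 c d) = a * c - b * d.
Proof. by rewrite /sprod !mxE !inordK //= eqxx. Qed.

(** Swapping [p] and [q] makes [v] orthogonal to [u], so with D = p^2 - q^2 the two sides differ by
    exactly [e * b * D] times [v]; the [a] term cancels. *)
Lemma parallel_isotropic_iff (R : realType) (p q e m n a b : R) :
    p ^+ 2 - q ^+ 2 != 0 -> e != 0 -> n != 0 ->
  let u := vec3 0 p q in
  let v := n *: vec3 0 q p in
  let w := e *: (a *: (m *: u) + b *: v) in
  sqnorm u *: w = sprod w u *: u <-> b = 0.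
Proof.
move=> pq0 e0 n0 u v w.
rewrite /w /v /u /sqnorm !(scale_vec3, add_vec3) !(mulr0, addr0).
rewrite !sprod_isotropic.
split=> [/vec3_inj[_ hp hq]|->]; last by congr vec3; ring.
set D := p ^+ 2 - q ^+ 2 in pq0.
(* Taking [p] times the third coordinate minus [q] times the second cancels all multiples of [u];
   the second factor [D] is [p * p - q * q], left by the [v] part. *)
have /eqP : e * n * D ^+ 2 * b = 0.
  by move: (congr1 ( *%R p) hq) (congr1 ( *%R q) hp); rewrite /D; lra.
by rewrite !mulf_eq0 (negPf e0) (negPf n0) (negPf pq0) => /eqP.
Qed.

Theorem theorem4p3 (R : realType) (I : interval R) (y z sigma : R -> R)
    (hadm : admissible I y z)
    (hfrenet : frenet_order3 I y z)
    (hsigma : equiform_parameter I y z sigma) :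
  equiform_AW3 I y z sigma <->
  (forall s : R, s \in I ->
     dparam sigma (equi_torsion y z) s
     - 3 * equi_curvature y z s * equi_torsion y z s = 0).
Proof.
(* Both conditions are pointwise; at a fixed [s] the derivatives enter only as real coefficients of
   N and B. *)
have AW3_at s : s \in I ->
    sqnorm (Q1 y z s) *: Q3 y z sigma s
      = sprod (Q3 y z sigma s) (Q1 y z s) *: Q1 y z s <->
    dparam sigma (equi_torsion y z) s
      - 3 * equi_curvature y z s * equi_torsion y z s = 0.
  move=> sI; have [_ _ /eqP yz /eqP yNz] := hadm s sI.
  have form0 : curv_form y z s != 0.
    by rewrite /curv_form subr_sqr mulf_neq0 ?subr_eq0 ?addr_eq0.
  have kappa0 : kappa y z s != 0.
    by rewrite /kappa gt_eqF // sqrtr_gt0 normr_gt0.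
  have rho0 : rho y z s != 0 by rewrite invr_eq0.
  have eps0 : eps y z s != 0 by rewrite sgr_eq0.
  (* One factor [rho] is the equiform scaling, the other is the 1/kappa inside [e2]; likewise for B
     and [e3]. *)
  have equiNE : equiN y z s =
      (rho y z s ^+ 2) *: vec3 0 (derive1n 2 y s) (derive1n 2 z s).
    by rewrite /equiN /e2 scalerA -expr2.
  have equiBE : equiB y z s = (rho y z s ^+ 2 * eps y z s) *:
      vec3 0 (derive1n 2 z s) (derive1n 2 y s).
    rewrite /equiB /e3 scalerA -/(rho y z s) -expr2 !scale_vec3.
    by congr vec3; ring.
  (* The powers of [rho] cancel, leaving the second derivative of the curve as [u]. *)
  have -> : Q1 y z s = vec3 0 (derive1n 2 y s) (derive1n 2 z s).
    by rewrite /Q1 equiNE scalerA mulVf ?scale1r ?expf_neq0.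
  rewrite /Q3 /= equiNE equiBE.
  (* Here e = rho^-4, m = rho^2, n = rho^2 eps, and b = T' - 3KT. *)
  apply: parallel_isotropic_iff => //.
  - by rewrite invr_eq0 expf_neq0.
  - by rewrite mulf_neq0 ?expf_neq0.
by split=> h s sI; apply/AW3_at => //; exact: h.
Qed.
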